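(* Let $X$ be a Banach space, let $A\subseteq X$ be bounded and convex, and let $a\in A$. For a sequence $\{V_n:n\in\mathbb{N}\}$ of non-empty subsets of $A$, the following conditions are equivalent: (i) $\{V_n:n\in\mathbb{N}\}$ is determining for $a$; (ii) for every slice $S$ of $A$ with $a\in S$, there is $m\in\mathbb{N}$ such that $V_m\subseteq S$; (iii) if $x_n\in V_n$ for every $n\in\mathbb{N}$, then $a\in\overline{\mathrm{conv}}(\{x_n:n\in\mathbb{N}\})$.
   Context: Banach spaces are over $\mathbb{K}=\mathbb{R}$ or $\mathbb{C}$; $X^*$ denotes the topological dual of $X$. A slice of a bounded set $A\subseteq X$ is a non-empty intersection of $A$ with an open half-space; it can be written as $S(A,x^*,\alpha)=\{x\in A:\operatorname{Re}x^*(x)>\sup_{b\in A}\operatorname{Re}x^*(b)-\alpha\}$ with $x^*\in X^*$, $\alpha>0$. For $A\subseteq X$ bounded and convex and $a\in A$, a countable collection $\{V_n:n\in\mathbb{N}\}$ of non-empty subsets of $A$ is determining for $a$ if $a\in\overline{\mathrm{conv}}(B)$ whenever $B\subseteq A$ intersects all the sets $V_n$. *)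

(* Defs.v *)
From HB Require Import structures.
From mathcomp Require Import all_boot all_order all_algebra.
From mathcomp Require Import complex.
From mathcomp Require Import all_classical all_reals.
From mathcomp Require Import topology normedtype convex.

Set Implicit Arguments.
Unset Strict Implicit.
Unset Printing Implicit Defensive.

Import Order.TTheory GRing.Theory Num.Theory.
Import numFieldNormedType.Exports.

Local Open Scope classical_set_scope.
Local Open Scope ring_scope.

Variant scalar_kind := RealScalars | ComplexScalars.

Definition scalars (R : realType) (k : scalar_kind) : numFieldType :=
  match k with
  | RealScalars => R
  | ComplexScalars => R[i]
  end.

Definition re (R : realType) (k : scalar_kind) : scalars R k -> R :=
  match k return scalars R k -> R with
  | RealScalars => fun z => z
  | ComplexScalars => fun z => complex.Re z
  end.
Arguments re {R k} z.

(* Convexity is taken with weights in {i01 K}. In R[i], 0 <= t <= 1 forces t to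
   be real, so these are the usual real weights for both scalar fields. *)
Definition conv_hull (K : numFieldType) (X : lmodType K) (B : set X) : set X :=
  smallest (@convex_set K X) B.

Definition closed_conv_hull (K : numFieldType) (X : normedModType K)
    (B : set X) : set X :=
  closure (conv_hull B).

(* The zero functional is allowed, as it is in the description of slices by
   S(A, f, alpha); see [sliceP]. *)
Definition open_half_space (R : realType) (k : scalar_kind)
    (X : normedModType (scalars R k)) (H : set X) : Prop :=
  exists (f : {linear X -> (scalars R k)^o}) (c : R),
    continuous f /\ H = [set x | c < re (f x)].

Definition is_slice (R : realType) (k : scalar_kind)
    (X : normedModType (scalars R k)) (A S : set X) : Prop :=
  S !=set0 /\ exists2 H : set X, open_half_space H & S = A `&` H.

Definition slice (R : realType) (k : scalar_kind)
    (X : normedModType (scalars R k)) (A : set X)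
    (f : {linear X -> (scalars R k)^o}) (alpha : R) : set X :=
  [set x | A x /\ sup [set re (f b) | b in A] - alpha < re (f x)].

Definition determining (R : realType) (k : scalar_kind)
    (X : normedModType (scalars R k)) (A : set X) (a : X) (V : nat -> set X) :
    Prop :=
  forall B : set X, B `<=` A -> (forall n, B `&` V n !=set0) ->
    closed_conv_hull B a.

Lemma re_le_norm (R : realType) (k : scalar_kind) (z M : scalars R k) :
  `|z| <= M -> re z <= re M.
Proof.
case: k z M => /= z M zM; first exact: le_trans (ler_norm z) zM.
have := le_trans (normc_ge_Re z) zM.
by rewrite lecE => /andP[_] /=; exact: le_trans (ler_norm _).
Qed.

Lemma has_sup_re (R : realType) (k : scalar_kind)
    (X : normedModType (scalars R k)) (A : set X)
    (f : {linear X -> (scalars R k)^o}) :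
  bounded_set A -> A !=set0 -> continuous f ->
  has_sup [set re (f b) | b in A].
Proof.
move=> bA [a Aa] /linear_bounded_continuous/bounded_funP fB.
split; first by exists (re (f a)), a.
have [r _ Ar] := ex_strict_bound_gt0 bA.
have [M fM] := fB r.
exists (re (M : scalars R k)) => _ [b Ab <-].
by apply: re_le_norm; apply: fM; apply/ltW/Ar.
Qed.

Lemma sliceP (R : realType) (k : scalar_kind)
    (X : normedModType (scalars R k)) (A S : set X) :
  bounded_set A -> A !=set0 ->
  is_slice A S <->
  exists (f : {linear X -> (scalars R k)^o}) (alpha : R),
    [/\ continuous f, 0 < alpha & S = slice A f alpha].
Proof.
move=> bA A0; split.
  move=> [[x Sx] [_ [f [c [fc ->]]] SE]].
  exists f, (sup [set re (f b) | b in A] - c).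
  split=> //; last first.
    by rewrite SE; apply/seteqP; split=> y; rewrite /slice/= subKr.
  rewrite subr_gt0.
  move: Sx; rewrite SE => -[Ax /= cx].
  apply: (lt_le_trans cx); apply: sup_upper_bound; first exact: has_sup_re.
  by exists x.
move=> [f [alpha [fc a0 ->]]]; split.
  have [_ [x Ax <-] lx] := sup_adherent a0 (has_sup_re bA A0 fc).
  by exists x.
exists [set x | sup [set re (f b) | b in A] - alpha < re (f x)] => //.
by exists f, (sup [set re (f b) | b in A] - alpha).
Qed.

(* Main.v *)
From HB Require Import structures.
Require Import Defs.
From mathcomp Require Import all_boot all_order all_algebra.
From mathcomp Require Import complex.
From mathcomp Require Import all_classical all_reals.
From mathcomp Require Import topology normedtype convex.
From mathcomp Require Import interval_inference ring lra.

Set Implicit Arguments.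
Unset Strict Implicit.
Unset Printing Implicit Defensive.

Import Order.TTheory GRing.Theory Num.Theory.
Import numFieldNormedType.Exports.

Local Open Scope classical_set_scope.
Local Open Scope ring_scope.

(** The equivalence runs in a cycle.

    If the family is determining but no [V m] lies inside a slice
    [S = A `&` H] containing [a], pick [x n] in [V n] outside [S]. The set of
    these points meets every [V n] and lies in the complement of the open
    half-space [H], which is convex and closed; hence so does its closed convex
    hull, and [a] would not be in [H] ([closed_conv_hull_half_space]).

    If every slice around [a] contains some [V m] and [a] is outside the closed
    convex hull of a choice [x n] in [V n], Hahn-Banach separates [a] from that
    hull by an open half-space ([separation]). It cuts a slice of [A] around
    [a], so it contains some [V m] and therefore [x m], which is on the other
    side.

    If all choices have [a] in their closed convex hull, a set meeting every
    [V n] contains the points of such a choice, and the hull is monotone.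

    The only deep ingredient is the separation of a point from a convex set
    over real or complex scalars. It is obtained without extending functionals
    from subspaces: a minimal sublinear functional exists by Zorn's lemma
    ([exists_minimal_sublinear]) and is automatically linear
    ([minimal_sublinear_scalar]). Both this and the passage from a convex set
    to a functional ([mazur_orlicz]) lower a given sublinear functional along a
    convex cone of constraints ([sublinear_tighten]). Complex spaces are seen
    as real ones, and a real functional [u] is the real part of the complex
    functional [x |-> u x - i u (i x)] ([functional_of_re]). *)

(** * Sublinear functionals and the Hahn-Banach theorem *)

(** Only one inequality is required of the homogeneity; applied to [t^-1] it
    gives the other one, see [sublinearZ]. *)
Definition sublinear (R : realType) (E : lmodType R) (q : E -> R) : Prop :=
  (forall x y, q (x + y) <= q x + q y) /\
  (forall t x, 0 <= t -> q (t *: x) <= t * q x).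

Lemma sublinear0 (R : realType) (E : lmodType R) (q : E -> R) :
  sublinear q -> q 0 = 0.
Proof.
move=> [qD qZ]; apply/eqP; rewrite eq_le.
have := qZ 0 0 (lexx _); rewrite scale0r mul0r => -> /=.
by have := qD 0 0; rewrite addr0 -subr_ge0 addrK.
Qed.

Lemma sublinearZ (R : realType) (E : lmodType R) (q : E -> R) (t : R) (x : E) :
  sublinear q -> 0 <= t -> q (t *: x) = t * q x.
Proof.
move=> qs; rewrite le_eqVlt => /predU1P[<-|t0].
  by rewrite scale0r mul0r sublinear0.
apply/eqP; rewrite eq_le (qs.2 _ _ (ltW t0))/= -ler_pdivlMl//.
have := qs.2 t^-1 (t *: x).
by rewrite scalerA mulVf ?gt_eqF// scale1r invr_ge0 ltW//; apply.
Qed.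

(** A sublinear functional is bounded below on translates: this is what keeps
    the infima below finite. *)
Lemma sublinear_geN (R : realType) (E : lmodType R) (q : E -> R) (x y : E) :
  sublinear q -> q y - q (- x) <= q (x + y).
Proof.
move=> [qD _]; rewrite lerBlDr.
by have := qD (x + y) (- x); rewrite addrAC subrr add0r.
Qed.

(** [W] is a convex cone of pairs [(w, s)], each a valid constraint [s <= q w].
    The functional [x |-> inf_W (q (x + w) - s)] is the largest sublinear
    [q' <= q] with [q' (- w) <= - s] on [W], so that every linear functional
    below it satisfies [s <= u w]. *)
Lemma sublinear_tighten (R : realType) (E : lmodType R) (q : E -> R)
    (W : set (E * R)) :
  sublinear q -> W !=set0 ->
  (forall v w, W v -> W w -> W (v.1 + w.1, v.2 + w.2)) ->
  (forall t w, 0 <= t -> W w -> W (t *: w.1, t * w.2)) ->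
  (forall w, W w -> w.2 <= q w.1) ->
  exists q' : E -> R,
    [/\ sublinear q', forall x, q' x <= q x &
        forall x w, W w -> q' x <= q (x + w.1) - w.2].
Proof.
move=> qs [w0 Ww0] WD WZ Wq.
have W0 : W (0, 0) by have := WZ 0 w0 (lexx _) Ww0; rewrite scale0r mul0r.
pose F x := [set q (x + w.1) - w.2 | w in W].
have F0 x : F x !=set0 by exists (q (x + 0) - 0), (0, 0).
have Flb x : has_lbound (F x).
  exists (- q (- x)) => _ [w Ww <-].
  have := sublinear_geN x w.1 qs; have := Wq w Ww; lra.
have ub x w : W w -> inf (F x) <= q (x + w.1) - w.2.
  by move=> Ww; apply: ge_inf => //; exists w.
exists (fun x => inf (F x)); split => //; last first.
  by move=> x; have := ub x _ W0; rewrite /= addr0 subr0.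
split=> [x y|t x].
  rewrite -lerBlDr; apply: lb_le_inf => // _ [v Wv <-].
  rewrite lerBlDr -lerBlDl; apply: lb_le_inf => // _ [w Ww <-].
  rewrite lerBlDl; apply: le_trans (ub _ _ (WD v w Wv Ww)) _ => /=.
  by rewrite addrACA; have := qs.1 (x + v.1) (y + w.1); lra.
rewrite le_eqVlt => /predU1P[<-|t0].
  by have := ub 0 _ W0; rewrite /= scale0r mul0r addr0 subr0 (sublinear0 qs).
rewrite -ler_pdivrMl//; apply: lb_le_inf => // _ [w Ww <-].
rewrite ler_pdivrMl// mulrBr; have := ub (t *: x) _ (WZ t w (ltW t0) Ww).
by rewrite /= -scalerDr (sublinearZ _ qs (ltW t0)).
Qed.

Definition minimal_sublinear (R : realType) (E : lmodType R) (q : E -> R) :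
    Prop :=
  sublinear q /\
  forall q', sublinear q' -> (forall x, q' x <= q x) -> forall x, q x <= q' x.

(** Zorn's lemma applies because the pointwise infimum of a chain of sublinear
    functionals below [p] is again sublinear; it is finite since every member
    [s] of the chain satisfies [- p (- x) <= s x]. *)
Lemma exists_minimal_sublinear (R : realType) (E : lmodType R) (p : E -> R) :
  sublinear p ->
  exists2 q : E -> R, minimal_sublinear q & forall x, q x <= p x.
Proof.
move=> ps.
pose T := {q : E -> R | sublinear q /\ forall x, q x <= p x}.
pose below (s t : T) := `[< forall x, sval t x <= sval s x >].
pose t0 : T := exist _ p (conj ps (fun x => lexx (p x))).
have [//| | |[q [qs qp]] qmin] := @ZL_preorder T t0 below.
- by move=> t; apply/asboolP.
- move=> r s t /asboolP rs /asboolP st; apply/asboolP => x.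
  exact: le_trans (st x) (rs x).
- move=> A Atot; have [[s0 As0]|A0] := pselect (A !=set0); last first.
    by exists t0 => s As; case: A0; exists s.
  pose F x := [set sval s x | s in A].
  have F0 x : F x !=set0 by exists (sval s0 x), s0.
  have Flb x : has_lbound (F x).
    exists (- p (- x)) => _ [[s [ss sp]] As <-] /=.
    have := sublinear_geN x 0 ss; have := sp (- x).
    rewrite addr0 (sublinear0 ss); lra.
  have ub x s : A s -> inf (F x) <= sval s x.
    by move=> As; apply: ge_inf => //; exists s.
  have infs : sublinear (fun x => inf (F x)).
    split=> [x y|t x t_ge0].
      rewrite -lerBlDr; apply: lb_le_inf => // _ [s As <-].
      rewrite lerBlDr -lerBlDl; apply: lb_le_inf => // _ [t At <-].
      rewrite lerBlDl.
      (* The lower of the two members of the chain bounds the infimum at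
         [x + y] by the sum of the values of both. *)
      have [/asboolP st|/asboolP ts] := Atot s t As At.
        apply: le_trans (ub _ t At) (le_trans ((svalP t).1.1 x y) _).
        by rewrite lerD2r.
      apply: le_trans (ub _ s As) (le_trans ((svalP s).1.1 x y) _).
      by rewrite lerD2l.
    move: t_ge0; rewrite le_eqVlt => /predU1P[<-|t_gt0].
      by rewrite scale0r mul0r -(sublinear0 (svalP s0).1); exact: ub.
    rewrite -ler_pdivrMl//; apply: lb_le_inf => // _ [s As <-].
    rewrite ler_pdivrMl//; apply: le_trans (ub _ s As) _.
    exact: (svalP s).1.2 (ltW t_gt0).
  have infp x : inf (F x) <= p x.
    exact: le_trans (ub x s0 As0) ((svalP s0).2 x).
  exists (exist _ (fun x => inf (F x)) (conj infs infp)) => s As.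
  by apply/asboolP => x; exact: ub.
exists q => //; split=> // q' qs' q'q.
have q'p x : q' x <= p x by exact: le_trans (q'q x) (qp x).
have /(_ _)/asboolP := qmin (exist _ q' (conj qs' q'p)).
by apply; apply/asboolP.
Qed.

(** Tightening [q] along the ray of the constraints [(t y, t q y)] cannot lower
    a minimal [q], and the constraint at [t = 1] then reads
    [q x <= q (x + y) - q y]. *)
Lemma minimal_sublinearD (R : realType) (E : lmodType R) (q : E -> R) (x y : E) :
  minimal_sublinear q -> q (x + y) = q x + q y.
Proof.
move=> [qs qmin]; apply/eqP; rewrite eq_le qs.1 /=.
pose W := [set w : E * R | exists2 t, 0 <= t & w = (t *: y, t * q y)].
have [| | | |q' [qs' q'q q'W]] := @sublinear_tighten R E q W qs.
- by exists (0 *: y, 0 * q y), 0.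
- move=> _ _ [s s0 ->] [t t0 ->]; exists (s + t); first exact: addr_ge0.
  by rewrite /= scalerDl mulrDl.
- move=> s _ s0 [t t0 ->]; exists (s * t); first exact: mulr_ge0.
  by rewrite /= scalerA mulrA.
- by move=> _ [t t0 ->] /=; rewrite (sublinearZ _ qs).
have Wy : W (y, q y) by exists 1; rewrite ?scale1r ?mul1r.
by rewrite -lerBrDr; apply: le_trans (qmin q' qs' q'q x) (q'W x _ Wy).
Qed.

Lemma minimal_sublinear_scalar (R : realType) (E : lmodType R) (q : E -> R) :
  minimal_sublinear q -> exists u : {scalar E}, u =1 q.
Proof.
move=> qm; have qs := qm.1.
have qD x y : q (x + y) = q x + q y by exact: minimal_sublinearD.
have qN x : q (- x) = - q x.
  by apply/eqP; rewrite -addr_eq0 -qD addNr sublinear0.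
have qZ t x : q (t *: x) = t * q x.
  have [t0|/ltW t0] := leP 0 t; first exact: sublinearZ.
  rewrite -[t]opprK scaleNr qN (sublinearZ _ qs) ?oppr_ge0//.
  by rewrite !mulNr opprK.
have qlin : scalar q by move=> t x y; rewrite qD qZ.
pose u : {scalar E} := HB.pack q (GRing.isLinear.Build R E R *%R q qlin).
by exists u.
Qed.

(** The Mazur-Orlicz form of the Hahn-Banach theorem. The constraints [r <= p d]
    for [d] in [D] generate the cone of the pairs [(t d, t r)], closed under
    addition because [D] is convex; a minimal sublinear functional below the
    tightening of [p] along this cone is the desired [u]. *)
Lemma mazur_orlicz (R : realType) (E : lmodType R) (p : E -> R) (D : set E)
    (r : R) :
  sublinear p -> D !=set0 ->
  (forall s t x y, 0 <= s -> 0 <= t -> s + t = 1 -> D x -> D y ->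
     D (s *: x + t *: y)) ->
  (forall d, D d -> r <= p d) ->
  exists u : {scalar E},
    (forall x, u x <= p x) /\ (forall d, D d -> r <= u d).
Proof.
move=> ps [d0 Dd0] Dconv rp.
pose W := [set w : E * R | exists2 t, 0 <= t &
  exists2 d, D d & w = (t *: d, t * r)].
have [| | | |p' [ps' p'p p'W]] := @sublinear_tighten R E p W ps.
- by exists (0 *: d0, 0 * r), 0 => //; exists d0.
- move=> _ _ [s s0 [d Dd ->]] [t t0 [e De ->]].
  exists (s + t); first exact: addr_ge0.
  (* [s d + t e] is [s + t] times a convex combination of [d] and [e]; when
     [s + t = 0] any point of [D] does. *)
  have [st0|st0] := eqVneq (s + t) 0.
    exists d0 => //=; have [-> ->] : s = 0 /\ t = 0 by split; lra.
    by rewrite !scale0r !mul0r !addr0 scale0r mul0r.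
  exists ((s / (s + t)) *: d + (t / (s + t)) *: e).
    by apply: Dconv; rewrite ?divr_ge0 ?addr_ge0// -mulrDl divff.
  by rewrite scalerDr !scalerA ![_ * (_ / _)]mulrC !divfK// mulrDl.
- move=> s _ s0 [t t0 [d Dd ->]]; exists (s * t); first exact: mulr_ge0.
  by exists d; rewrite //= scalerA mulrA.
- move=> _ [t t0 [d Dd ->]] /=; rewrite (sublinearZ _ ps)//.
  by rewrite ler_wpM2l// rp.
have [q /minimal_sublinear_scalar[u uq] qp'] := exists_minimal_sublinear ps'.
exists u; split=> [x|d Dd].
  by rewrite uq; apply: le_trans (qp' x) (p'p x).
have -> : u d = - q (- d) by rewrite -uq raddfN opprK.
rewrite lerNr; apply: le_trans (qp' _) _.
have Wd : W (d, r).
  by exists 1 => //; exists d; rewrite ?scale1r ?mul1r.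
by have := p'W (- d) _ Wd; rewrite /= addNr (sublinear0 ps) sub0r.
Qed.

(** * Real and complex spaces as real spaces *)

Definition real_scalar (R : realType) (k : scalar_kind) : R -> scalars R k :=
  match k return R -> scalars R k with
  | RealScalars => fun t => t
  | ComplexScalars => fun t => real_complex R t
  end.

Section RealScalar.
Variables (R : realType) (k : scalar_kind).
Implicit Types (s t : R) (z w : scalars R k).
Let iota := @real_scalar R k.

Lemma real_scalar_is_monoid_morphism : monoid_morphism iota.
Proof.
rewrite /iota; case: k => /=; first by split.
by split=> [|x y]; [exact: rmorph1 | exact: rmorphM].
Qed.

Lemma real_scalar_is_zmod_morphism : zmod_morphism iota.
Proof.
by rewrite /iota; case: k => //= x y; exact: rmorphB.
Qed.

HB.instance Definition _ := GRing.isZmodMorphism.Build R (scalars R k)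
  (@real_scalar R k) real_scalar_is_zmod_morphism.
HB.instance Definition _ := GRing.isMonoidMorphism.Build R (scalars R k)
  (@real_scalar R k) real_scalar_is_monoid_morphism.

Lemma re_is_zmod_morphism : zmod_morphism (@re R k).
Proof. by case: k => //= -[a b] [c d]. Qed.

HB.instance Definition _ := GRing.isZmodMorphism.Build (scalars R k) R
  (@re R k) re_is_zmod_morphism.

Lemma re_real_scalar t : re (real_scalar k t) = t.
Proof. by case: k. Qed.

Lemma reZ t z : re (real_scalar k t * z) = t * re z.
Proof. by case: k z => //= -[a b] /=; rewrite mul0r subr0. Qed.

Lemma ler_re z w : z <= w -> re z <= re w.
Proof. by case: k z w => //= z w; rewrite lecE => /andP[]. Qed.

Lemma ltr_re z w : z < w -> re z < re w.
Proof. by case: k z w => //= z w; rewrite ltcE => /andP[]. Qed.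

Lemma ler_real_scalar s t : (real_scalar k s <= real_scalar k t) = (s <= t).
Proof. by case: k => //=; rewrite lecE /= eqxx. Qed.

Lemma ltr_real_scalar s t : (real_scalar k s < real_scalar k t) = (s < t).
Proof. by case: k => //=; rewrite ltcE /= eqxx. Qed.

Lemma real_scalar_re z : 0 <= z -> real_scalar k (re z) = z.
Proof. by case: k z => //= z z0; rewrite RRe_real ?ger0_real. Qed.

End RealScalar.

(** A copy of the carrier, so that the module structure over the reals does not
    compete with the one over [scalars R k]. *)
Definition realified (R : realType) (k : scalar_kind)
  (X : lmodType (scalars R k)) : Type := X.

Section Realified.
Variables (R : realType) (k : scalar_kind) (X : lmodType (scalars R k)).

Let rscale (t : R) (x : realified X) : realified X :=
  (real_scalar k t : scalars R k) *: (x : X).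

HB.instance Definition _ := GRing.Zmodule.on (realified X).

Let rscaleA s t x : rscale s (rscale t x) = rscale (s * t) x.
Proof. by rewrite /rscale scalerA rmorphM. Qed.
Let rscale1 : left_id 1 rscale.
Proof. by move=> x; rewrite /rscale rmorph1 scale1r. Qed.
Let rscaleDr : right_distributive rscale +%R.
Proof. by move=> t x y; rewrite /rscale scalerDr. Qed.
Let rscaleDl x : {morph rscale^~ x : s t / s + t}.
Proof. by move=> s t; rewrite /rscale rmorphD scalerDl. Qed.

HB.instance Definition _ := GRing.Zmodule_isLmodule.Build R (realified X)
  rscaleA rscale1 rscaleDr rscaleDl.

Lemma realifiedZ (t : R) (x : realified X) :
  t *: x = real_scalar k t *: (x : X).
Proof. by []. Qed.

End Realified.

Definition real_norm (R : realType) (k : scalar_kind)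
  (X : normedModType (scalars R k)) (x : realified X) : R := re `|x : X|.

Lemma real_norm_sublinear (R : realType) (k : scalar_kind)
  (X : normedModType (scalars R k)) : sublinear (@real_norm R k X).
Proof.
split=> [x y|t x t0].
  by rewrite /real_norm -raddfD ler_re ?ler_normD.
rewrite /real_norm realifiedZ normrZ -reZ ger0_norm//.
by rewrite -(rmorph0 (@real_scalar R k)) ler_real_scalar.
Qed.

(** Over the complex numbers the functional is [x |-> u x - i u (i x)], whose
    norm is at most twice that of [u]. *)
Lemma functional_of_re (R : realType) (k : scalar_kind)
    (X : normedModType (scalars R k)) (u : {scalar (realified X)}) :
  (forall x, u x <= real_norm x) ->
  exists f : {linear X -> (scalars R k)^o},
    continuous f /\ forall x, re (f x) = u x.
Proof.
move=> u_le.

case: k X u u_le => X u u_le.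
  pose f : {linear X -> R^o} := HB.pack (u : X -> R^o)
    (GRing.isLinear.Build R X R^o *:%R (u : X -> R^o) (linearP u)).
  exists f; split=> //; apply: bounded_linear_continuous; apply/bounded_funP.
  move=> r; exists r => x xr; apply: le_trans xr.
  have := u_le (- x); rewrite raddfN /real_norm /= normrN => uNx.
  by rewrite ler_norml lerNl uNx u_le.
pose g (x : X) : R[i]^o := Complex (u x) (- u (('i%C : R[i]) *: x)).
have uD (x y : X) : u (x + y) = u x + u y by exact: raddfD u x y.
have uZ t (x : X) : u (real_complex R t *: x) = t * u x by exact: scalarZ u t x.
have glin : linear g.
  move=> [a b] x y.
  have iE (v : X) : (Complex a b : R[i]) *: v =
      real_complex R a *: v + real_complex R b *: (('i%C : R[i]) *: v).
    rewrite scalerA -scalerDl; congr (_ *: _).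
    by apply/eqP; rewrite eq_complex /=; apply/andP; split; apply/eqP; ring.
  have iiE (v : X) : ('i%C : R[i]) *: ((Complex a b : R[i]) *: v) =
      real_complex R a *: (('i%C : R[i]) *: v) + real_complex R (- b) *: v.
    rewrite !scalerA -scalerDl; congr (_ *: _).
    by apply/eqP; rewrite eq_complex /=; apply/andP; split; apply/eqP; ring.
  rewrite /g !scalerDr iiE iE !uD !uZ.
  by apply/eqP; rewrite eq_complex /=; apply/andP; split; apply/eqP; ring.
pose f : {linear X -> R[i]^o} := HB.pack g
  (GRing.isLinear.Build R[i] X R[i]^o *:%R g glin).
exists f; split=> //; apply: bounded_linear_continuous; apply/bounded_funP.
move=> r; exists (r + r) => x xr.
have u_abs (v : X) : `|u v| <= complex.Re `|v|.
  have := u_le (- v); rewrite raddfN /real_norm /= normrN => uNv.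
  by rewrite ler_norml lerNl uNv u_le.
have gE : g x = real_complex R (u x) - 'i%C * real_complex R (u ('i%C *: x)).
  by apply/eqP; rewrite eq_complex /=; apply/andP; split; apply/eqP; ring.
have norm_rc (t : R) : `|real_complex R t| = real_complex R `|t|.
  by rewrite normc_def /= expr0n /= addr0 sqrtr_sqr.
have norm_i : `|'i%C : R[i]| = 1.
  by rewrite normc_def /= expr0n expr1n /= add0r sqrtr1.
have u_abs' (v : X) : real_complex R `|u v| <= `|v|.
  rewrite -[leRHS]RRe_real ?ger0_real//.
  by rewrite lecE /= eqxx u_abs.
rewrite [f x]gE; apply: le_trans (ler_normB _ _) _.
rewrite normrM norm_i mul1r !norm_rc; apply: lerD.
  exact: le_trans (u_abs' _) xr.
by apply: le_trans (u_abs' _) _; rewrite normrZ norm_i mul1r.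
Qed.

(** * Convex hulls, half-spaces and separation *)

Lemma conv_hull_convex (K : numFieldType) (X : lmodType K) (B : set X) :
  @convex_set K X (conv_hull B).
Proof.
move=> x y l; rewrite !inE => hx hy D CD; apply/set_mem.
by apply: CD.1; apply/mem_set; [exact: hx | exact: hy].
Qed.

Lemma closed_conv_hullS (K : numFieldType) (X : normedModType K)
  (B C : set X) : B `<=` C -> closed_conv_hull B `<=` closed_conv_hull C.
Proof.
move=> BC; apply: closureS; apply: smallest_sub; first exact: conv_hull_convex.
by apply: subset_trans BC _; exact: sub_gen_smallest.
Qed.

Section HalfSpaces.
Local Open Scope convex_scope.
Variables (R : realType) (k : scalar_kind) (X : normedModType (scalars R k)).
Implicit Types (B C : set X) (f : {linear X -> (scalars R k)^o}) (c : R).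

Lemma convex_set_real C s t (x y : X) : @convex_set _ X C ->
  0 <= s -> 0 <= t -> s + t = 1 -> C x -> C y ->
  C (real_scalar k s *: x + real_scalar k t *: y).
Proof.
move=> Cconv s0 t0 st Cx Cy.
have i0 : 0 <= real_scalar k s.
  by rewrite -(rmorph0 (@real_scalar R k)) ler_real_scalar.
have i1 : real_scalar k s <= 1.
  by rewrite -(rmorph1 (@real_scalar R k)) ler_real_scalar// -st lerDl.
have tE : real_scalar k t = 1 - real_scalar k s.
  by rewrite -(rmorph1 (@real_scalar R k)) -st rmorphD addrAC subrr add0r.
rewrite tE; apply/set_mem.
by apply: (Cconv x y (Itv01 i0 i1)); exact/mem_set.
Qed.

Lemma convex_half_space f c : @convex_set _ X [set x | re (f x) <= c].
Proof.
move=> x y l; rewrite !inE /= => fx fy.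
have [t tE] : exists t, l%:num = real_scalar k t.
  by exists (re l%:num); rewrite real_scalar_re.
have t0 : 0 <= t.
  have : real_scalar k 0 <= real_scalar k t by rewrite rmorph0 -tE.
  by rewrite ler_real_scalar.
have t1 : 0 <= 1 - t.
  have : real_scalar k t <= real_scalar k 1 by rewrite rmorph1 -tE.
  by rewrite ler_real_scalar subr_ge0.
have -> : x <| l |> y = real_scalar k t *: x + real_scalar k (1 - t) *: y.
  by rewrite rmorphB rmorph1 /= -tE.
rewrite linearD !linearZ /= raddfD /= !reZ.
by have := ler_wpM2l t0 fx; have := ler_wpM2l t1 fy; lra.
Qed.

(** A point of the open half-space beyond [c] has a neighbourhood there, which
    cannot meet the convex hull of [B]. *)
Lemma closed_conv_hull_half_space f c B a : continuous f ->
  (forall b, B b -> re (f b) <= c) -> closed_conv_hull B a -> re (f a) <= c.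
Proof.
move=> fc Bc Ba; rewrite leNgt; apply/negP => ca.
have e0 : 0 < real_scalar k (re (f a) - c).
  by rewrite -(rmorph0 (@real_scalar R k)) ltr_real_scalar subr_gt0.
have fa := (@cvgrPdist_lt _ _ _ (nbhs a) _ f (f a)).1 (fc a) _ e0.
have [y [/(smallest_sub (@convex_half_space f c) Bc) /= yc]] := Ba _ (fa (nbhs_filter a)).
move=> /= /ltr_re; rewrite re_real_scalar.
have := re_le_norm (lexx `|f a - f y|); rewrite raddfB.
lra.
Qed.

(** If [a] is at distance at least [e] from [C], the norm is at least [e] on the
    convex set [a - C], and [mazur_orlicz] gives a functional dominated by the
    norm, hence continuous, that is still at least [e] on [a - C]. *)
Lemma separation C a : @convex_set _ X C -> C !=set0 -> ~ closure C a ->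
  exists f c, [/\ continuous f, forall y, C y -> re (f y) <= c &
    c < re (f a)].
Proof.
move=> Cconv [y0 Cy0] Ca.
have [e e0 Ce] : exists2 e : scalars R k, 0 < e &
    forall y, C y -> e <= `|a - y|.
  apply: contra_notP Ca => noe B /nbhs_normP[e /= e0 eB].
  apply: contrapT => CB; apply: noe; exists e => // y Cy.
  rewrite real_leNgt ?normr_real ?gtr0_real//; apply/negP => aye.
  by apply: CB; exists y; split=> //; apply: eB.
pose D : set (realified X) := [set d | exists2 y, C y & d = a - y].
have [| | |u [up uD]] := @mazur_orlicz R (realified X) _ D (re e)
  (@real_norm_sublinear R k X).
- by exists (a - y0), y0.
- move=> s t _ _ s0 t0 st [y Cy ->] [z Cz ->].
  exists (real_scalar k s *: y + real_scalar k t *: z).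
    exact: convex_set_real.
  by rewrite !scalerBr addrACA -opprD -scalerDl st scale1r.
- by move=> _ [y Cy ->]; apply: ler_re; exact: Ce.
have [f [fc fu]] := functional_of_re up.
exists f, (re (f a) - re e); split=> //.
  move=> y Cy; have := uD (a - y) (ex_intro2 _ _ y Cy erefl).
  by rewrite -fu linearB raddfB /= lerBrDr addrC -lerBrDr.
by rewrite ltrBlDr ltrDl; have := ltr_re e0; rewrite raddf0.
Qed.

End HalfSpaces.

(** * Determining sequences *)

Theorem proposition2p3 (R : realType) (k : scalar_kind)
    (X : completeNormedModType (scalars R k))
    (A : set X) (bounded_A : bounded_set A) (convex_A : @convex_set _ X A)
    (a : X) (Aa : A a)
    (V : nat -> set X) (V_neq0 : forall n, V n !=set0)
    (V_sub : forall n, V n `<=` A) :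
  [<-> determining A a V;
       forall S : set X, is_slice A S -> S a -> exists m, V m `<=` S;
       forall x : nat -> X, (forall n, V n (x n)) ->
         closed_conv_hull (range x) a].
Proof.
tfae.
- move=> detV S [_ [H [f [c [fc HE]] SE]]] Sa; apply: contrapT => noV.
  have /choice[x xP] n : exists x, V n x /\ ~ S x.
    apply: contrapT => VS; apply: noV; exists n => x Vx.
    by apply: contrapT => Sx; apply: VS; exists x.
  have xa : closed_conv_hull (range x) a.
    apply: detV => [_ [n _ <-]|n]; first exact: V_sub (xP n).1.
    by exists (x n); split; [exists n | exact: (xP n).1].
  move: Sa; rewrite SE HE => -[_ /=]; rewrite ltNge => /negP; apply.
  apply: closed_conv_hull_half_space fc _ xa => _ [n _ <-].
  rewrite leNgt; apply/negP => cx; apply: (xP n).2; rewrite SE HE.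
  by split=> //; exact: V_sub (xP n).1.
- move=> sliceV x xV; apply: contrapT => xa.
  have x0 : conv_hull (range x) (x 0%N) by apply: sub_gen_smallest; exists 0%N.
  have [f [c [fc xc ca]]] := separation (@conv_hull_convex _ _ _)
    (ex_intro _ _ x0) xa.
  have [||m VS] := sliceV (A `&` [set y | c < re (f y)]).
  + by split; [exists a | exists [set y | c < re (f y)] => //; exists f, c].
  + by [].
  have [_ /=] := VS _ (xV m); rewrite ltNge xc//.
  by apply: sub_gen_smallest; exists m.
- move=> convV B BA BV.
  have /choice[x xP] n : exists x, B x /\ V n x by have [x] := BV n; exists x.
  apply: (@closed_conv_hullS _ _ (range x)) => [_ [n _ <-]|].
    exact: (xP n).1.
  by apply: convV => n; exact: (xP n).2.
Qed.
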